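(* Let $\widetilde{W}$ be an affine Weyl group of type $\widetilde{A}_2$, $\widetilde{B}_2=\widetilde{C}_2$ or $\widetilde{G}_2$, with positive system $\widetilde\Phi^+$. The poset $\mathscr{B}(\widetilde{\Phi}^+)$ of biclosed subsets of $\widetilde\Phi^+$, ordered by inclusion, is a complete ortholattice.
   Context: Affine setting: $\Phi$ is the irreducible crystallographic root system (finite and reduced, here of type $A_2$, $B_2$ or $G_2$) of a Weyl group, spanning a Euclidean space $V$ with inner product $(\cdot,\cdot)$, with a fixed positive system $\Phi^+$, simple system $\Pi$, $\Phi^-=-\Phi^+$. Let $V'=V\oplus\mathbb{R}\delta$, with the inner product extended by $(\delta,V')=0$. For $\alpha\in\Phi^+$ let $\widehat{\alpha}=\{\alpha+n\delta : n\in\mathbb{Z}_{\ge0}\}$; for $\alpha\in\Phi^-$ let $\widehat{\alpha}=\{\alpha+(n+1)\delta : n\in\mathbb{Z}_{\ge0}\}$; $\widetilde\Phi^+=\widehat{\Phi}=\bigcup_{\alpha\in\Phi}\widehat{\alpha}$. This is the positive system, with simple roots $\Pi\cup\{\delta-\gamma\}$ ($\gamma$ the highest root of $\Phi$), of the root system $\widehat\Phi\cup-\widehat\Phi$ of $\widetilde W$. A set $\Gamma\subset\widetilde\Phi^+$ is closed if $\alpha,\beta\in\Gamma$, $k_1,k_2\in\mathbb{R}_{\ge0}$ and $k_1\alpha+k_2\beta\in\widetilde\Phi^+$ imply $k_1\alpha+k_2\beta\in\Gamma$; it is biclosed if both $\Gamma$ and $\widetilde\Phi^+\setminus\Gamma$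 are closed. An ortholattice is a lattice with a minimum $0$ and a maximum $1$ and an order-reversing involution $x\mapsto x^{oc}$ such that $x\wedge x^{oc}=0$ and $x\vee x^{oc}=1$ for all $x$. A complete ortholattice is an ortholattice that is a complete lattice. *)

(* Defs.v *)
From HB Require Import structures.
From mathcomp Require Import all_boot all_order all_algebra all_fingroup.
From mathcomp Require Import all_classical reals.

Set Implicit Arguments.
Unset Strict Implicit.
Unset Printing Implicit Defensive.

Import Order.TTheory GRing.Theory Num.Theory.

Local Open Scope classical_set_scope.
Local Open Scope ring_scope.

Section Ortholattice.
Context {d : Order.disp_t} (T : porderType d).

Definition is_lattice : Prop := forall x y : T,
  (exists m, infimums [set x; y] m) /\ (exists j, supremums [set x; y] j).

Definition is_complete_lattice : Prop := forall A : set T,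
  (exists m, infimums A m) /\ (exists j, supremums A j).

Definition is_ortholattice : Prop :=
  is_lattice /\
  exists (bot top : T) (oc : T -> T),
    [/\ forall x, (bot <= x <= top)%O,
        involutive oc,
        forall x y, (x <= y)%O -> (oc y <= oc x)%O,
        forall x, infimums [set x; oc x] bot
      & forall x, supremums [set x; oc x] top].

Definition is_complete_ortholattice : Prop :=
  is_ortholattice /\ is_complete_lattice.

End Ortholattice.

Section FiniteRootSystem.
Context {R : realType} {V : vectType R} (ip : {dot V for idfun}).

Definition cartan_number (a b : V) : R := 2 * ip a b / ip b b.

Definition reflection (b a : V) : V := a - cartan_number a b *: b.

(* The list representation accounts for the finiteness of the root system. *)
Record root_system (Phi : seq V) : Prop := RootSystem {
  root_neq0 : 0 \notin Phi;
  root_span : <<Phi>>%VS = fullv;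
  root_reflection : {in Phi &, forall a b, reflection b a \in Phi}
}.

Definition crystallographic (Phi : seq V) : Prop :=
  {in Phi &, forall a b, cartan_number a b \is a Num.int}.

Definition reduced (Phi : seq V) : Prop :=
  forall (a : V) (c : R), a \in Phi -> c *: a \in Phi -> c = 1 \/ c = -1.

Definition irreducible (Phi : seq V) : Prop :=
  Phi <> [::] /\
  forall P : pred V,
    {in Phi &, forall a b, P a -> ~~ P b -> ip a b = 0} ->
    {in Phi, forall a, P a} \/ {in Phi, forall a, ~~ P a}.

Section SimpleSystem.
Context (Phi : seq V) (n : nat) (Pi : n.-tuple V).

Definition pos_root : pred V :=
  [pred a in Phi | [forall i, 0 <= coord Pi i a]].

Definition neg_root : pred V := [pred a | pos_root (- a)].

Record simple_system : Prop := SimpleSystem {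
  simple_root : {subset Pi <= Phi};
  simple_basis : basis_of fullv Pi;
  simple_sign : {in Phi, forall a, pos_root a || neg_root a}
}.

End SimpleSystem.

Inductive rank2_type := A2 | B2 | G2.

(* Bourbaki's Cartan matrices; in B2 the first simple root is the long one,
   in G2 it is the short one. *)
Definition cartan_matrix (X : rank2_type) : 'M[int]_2 :=
  let c12_c21 : int * int :=
    match X with A2 => (-1, -1) | B2 => (-2, -1) | G2 => (-1, -3) end in
  \matrix_(i < 2, j < 2)
    (if i == j then 2 else if i == 0 then c12_c21.1 else c12_c21.2).

Definition has_type (X : rank2_type) (Pi : 2.-tuple V) : Prop :=
  exists s : 'S_2, forall i j : 'I_2,
    cartan_number (tnth Pi (s i)) (tnth Pi (s j)) = (cartan_matrix X i j)%:~R.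

End FiniteRootSystem.

Section AffineRoots.
Context {R : realType} {V : vectType R}.

(* V * R^o is V (+) R delta, with R delta as its second summand. *)
Definition delta : (V * R^o)%type := (0, 1).

Definition aff_root (a : V) (k : nat) : (V * R^o)%type :=
  (a, 0) + k%:R *: delta.

Definition hat (Phi : seq V) (n : nat) (Pi : n.-tuple V) (a : V) :
    set (V * R^o)%type :=
  if pos_root Phi Pi a then [set aff_root a k | k in [set: nat]]
  else [set aff_root a k.+1 | k in [set: nat]].

Definition aff_pos (Phi : seq V) (n : nat) (Pi : n.-tuple V) :
    set (V * R^o)%type :=
  \bigcup_(a in [set` Phi]) hat Phi Pi a.

End AffineRoots.

Section Biclosed.
Context {R : realType} {U : lmodType R} (Psi : set U).

Definition closed_in (G : set U) : Prop :=
  G `<=` Psi /\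
  forall (a b : U) (k1 k2 : R), G a -> G b -> 0 <= k1 -> 0 <= k2 ->
    Psi (k1 *: a + k2 *: b) -> G (k1 *: a + k2 *: b).

Definition biclosed : set (set U) :=
  [set G | closed_in G /\ closed_in (Psi `\` G)].

Definition biclosed_poset : Type := {G : set U | G \in biclosed}.

HB.instance Definition _ := [isSub of biclosed_poset for @sval _ _].
HB.instance Definition _ := [Choice of biclosed_poset by <:].
(* The order is inclusion, inherited from set U; see biclosed_poset_leE. *)
HB.instance Definition _ :=
  [SubChoice_isSubPOrder of biclosed_poset by <: with set_display].

Lemma biclosed_poset_leE (G H : biclosed_poset) :
  (G <= H)%O <-> val G `<=` val H.
Proof. by split=> [/subsetPset|/subsetPset]. Qed.

End Biclosed.

(* Main.v *)
Require Import Defs.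
From HB Require Import structures.
From mathcomp Require Import all_boot all_order all_algebra all_fingroup.
From mathcomp Require Import all_classical reals.
From mathcomp Require Import zify ring lra.

(* The supremum of a family of biclosed sets is the closure C of its union S.
   As S is coclosed, it suffices that the closure of a coclosed set is
   coclosed.  Order the positive affine roots by a positive linear functional
   (level) and let C be generated from S by the steps "a, b in C, z in the cone
   of a and b, z of larger level than a and b".  That C is closed and coclosed
   is proved by adding the roots one at a time in order of level.  The last root
   z is never extreme among the roots added so far in a rank 2 subsystem, as soon
   as there are three of them, so the only danger is a conflict: one rank 2
   subsystem through z forces z into C and another one forces z out.  In one not
   containing delta, the neighbours of z among the earlier roots sum to z.  If
   x + y = z = u + w with x, y out and u, w in, then either some difference
   such as x - u is a root, whose membership is contradictory, or {x, y} and
   {u, w} have the same finite parts, which is contradictory through roots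
   congruent to x + y, -x and -y modulo delta; the subsystem containing delta is
   handled in the same way. *)

Set Implicit Arguments.
Unset Strict Implicit.
Unset Printing Implicit Defensive.

Import Order.TTheory GRing.Theory Num.Theory.

Local Open Scope classical_set_scope.
Local Open Scope ring_scope.

(** * Affine roots as integer triples *)

(* The pair (m, n) stands for m a1 + n a2, in Bourbaki's numbering of the simple
   roots, and (c, k) for c + k delta. *)
Local Notation vec := (int * int)%type.

Definition pos_coords (X : rank2_type) : seq vec :=
  match X with
  | A2 => [:: (1, 0); (0, 1); (1, 1)]
  | B2 => [:: (1, 0); (0, 1); (1, 1); (1, 2)]
  | G2 => [:: (1, 0); (0, 1); (1, 1); (2, 1); (3, 1); (3, 2)]
  end.

Definition coords (X : rank2_type) : seq vec :=
  pos_coords X ++ [seq - c | c <- pos_coords X].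

Definition vdet (a b : vec) : int := a.1 * b.2 - a.2 * b.1.

(* The weights make height injective on the roots, with the sign of the root;
   100 exceeds twice its maximum, so that level is injective on the affine
   roots, and positive exactly on the positive ones. *)
Definition height (c : vec) : int := 10 * c.1 + c.2.

Definition level (x : vec * int) : int := 100 * x.2 + height x.1.

(* z lies in the open cone spanned by a and b, with denominators cleared. *)
Definition between (a z b : vec * int) : Prop := exists D p q : int,
  [/\ 0 < D, 0 < p, 0 < q &
      [/\ D * z.1.1 = p * a.1.1 + q * b.1.1,
          D * z.1.2 = p * a.1.2 + q * b.1.2 & D * z.2 = p * a.2 + q * b.2]].

(** * Finite checks on the tables of roots *)

Section Tables.
Variable X : rank2_type.
Local Notation T := (coords X).

Lemma coordsN c : c \in T -> - c \in T.
Proof.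
have: all (fun c => - c \in T) T by case: X; vm_compute.
by move/allP; apply.
Qed.

Lemma height_bound c : c \in T -> height c != 0 /\ `|height c| < 50.
Proof.
have: all (fun c => (height c != 0) && (`|height c| < 50)) T.
  by case: X; vm_compute.
by move/allP => H /H /andP[].
Qed.

Lemma height_inj : {in T &, injective height}.
Proof.
have H : all (fun a => all (fun b => (height a == height b) ==> (a == b)) T) T.
  by case: X; vm_compute.
move=> a b aT bT /eqP hab; apply/eqP.
exact: implyP (allP (allP H _ aT) _ bT) hab.
Qed.

Lemma vdet_eq0 a b : a \in T -> b \in T -> vdet a b = 0 -> b = a \/ b = - a.
Proof.
have H : all (fun a => all (fun b =>
  (vdet a b == 0) ==> ((b == a) || (b == - a))) T) T by case: X; vm_compute.
move=> aT bT /eqP d0.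
by case/orP: (implyP (allP (allP H _ aT) _ bT) d0) => /eqP; [left|right].
Qed.

(** Two ways of writing a root as a sum of two roots agree up to order or are linked by a further
    root. The enumeration needs only triples, as w is x + y - u. *)
Lemma sum_exchange x y u w : x \in T -> y \in T -> u \in T -> w \in T ->
  x + y \in T -> x + y = u + w ->
  [\/ u = x, u = y, x - u \in T | y - u \in T].
Proof.
have H : all (fun x => all (fun y => all (fun u =>
  [&& x + y \in T & x + y - u \in T] ==>
  [|| u == x, u == y, x - u \in T | y - u \in T]) T) T) T.
  by case: X; vm_compute.
move=> xT yT uT wT sT e.
have := implyP (allP (allP (allP H _ xT) _ yT) _ uT).
rewrite sT {1}e addrAC subrr add0r wT => /(_ isT).
by case/or4P => [/eqP|/eqP||];
  [constructor 1|constructor 2|constructor 3|constructor 4].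
Qed.

(** Cramer's rule replaces D, p, q by proportional integers that depend only on a, z and b, so that
    the next two lemmas become finite checks. The extra factor [vdet a b] makes these integers
    positive. *)
Lemma vdet_ratio a z b (D p q : int) :
  0 < D -> 0 < p -> 0 < q ->
  D * z.1 = p * a.1 + q * b.1 -> D * z.2 = p * a.2 + q * b.2 ->
  vdet a b != 0 ->
  exists d p' q' : int,
    [/\ d = vdet a b * vdet a b, p' = vdet z b * vdet a b, q' = vdet a z * vdet a b &
        [/\ 0 < d, 0 < p', 0 < q', D * p' = p * d & D * q' = q * d]].
Proof.
move=> D0 p0 q0 e1 e2 d0.
have ep : D * (vdet z b * vdet a b) = p * (vdet a b * vdet a b).
  have -> : D * (vdet z b * vdet a b) =
    ((D * z.1) * b.2 - (D * z.2) * b.1) * vdet a b by rewrite /vdet; ring.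
  by rewrite e1 e2 /vdet; ring.
have eq : D * (vdet a z * vdet a b) = q * (vdet a b * vdet a b).
  have -> : D * (vdet a z * vdet a b) =
    (a.1 * (D * z.2) - a.2 * (D * z.1)) * vdet a b by rewrite /vdet; ring.
  by rewrite e1 e2 /vdet; ring.
have dd : 0 < vdet a b * vdet a b by rewrite lt0r mulf_neq0 //= -expr2 sqr_ge0.
exists (vdet a b * vdet a b), (vdet z b * vdet a b), (vdet a z * vdet a b).
split=> //; split=> //.
  by rewrite -(pmulr_rgt0 _ D0) ep mulr_gt0.
by rewrite -(pmulr_rgt0 _ D0) eq mulr_gt0.
Qed.

(* The condition D < p + q excludes the cases such as (a + b) / 2, where z has at
   most the level of a or b. *)
Lemma decompose_middle a z b (D p q : int) :
  a \in T -> z \in T -> b \in T -> vdet a b != 0 ->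
  0 < D -> 0 < p -> 0 < q -> D < p + q ->
  D * z.1 = p * a.1 + q * b.1 -> D * z.2 = p * a.2 + q * b.2 ->
  (D <= p /\ z - a \in T) \/ (D <= q /\ z - b \in T).
Proof.
have H : all (fun a => all (fun z => all (fun b =>
  let d := vdet a b * vdet a b in let p := vdet z b * vdet a b in
  let q := vdet a z * vdet a b in
  [&& 0 < d, 0 < p, 0 < q & d < p + q] ==>
  ((d <= p) && (z - a \in T) || (d <= q) && (z - b \in T))) T) T) T.
  by case: X; vm_compute.
move=> aT zT bT d0 D0 p0 q0 Dpq e1 e2.
have [d [p' [q' [ed ep eq [dd dp dq e3 e4]]]]] := vdet_ratio D0 p0 q0 e1 e2 d0.
have /= := allP (allP (allP H _ aT) _ zT) _ bT.
rewrite -ed -ep -eq dd dp dq /= => /implyP.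
have -> : d < p' + q' by nia.
move=> /(_ isT) /orP[]/andP[h1 h2]; [left|right]; split=> //; nia.
Qed.

(** In [before_end] the root a has the largest level, which forces p < D. The three alternatives are
    the candidates there for an earlier root lying beyond a. *)
Lemma decompose_end a z b (D p q : int) :
  a \in T -> z \in T -> b \in T -> vdet a b != 0 ->
  0 < D -> 0 < p -> 0 < q -> p < D ->
  D * z.1 = p * a.1 + q * b.1 -> D * z.2 = p * a.2 + q * b.2 ->
  [\/ a - z \in T, a - b \in T | [/\ z - b \in T, q < D & D <= p + q]].
Proof.
have H : all (fun a => all (fun z => all (fun b =>
  let d := vdet a b * vdet a b in let p := vdet z b * vdet a b in
  let q := vdet a z * vdet a b in
  [&& 0 < d, 0 < p, 0 < q & p < d] ==>
  [|| a - z \in T, a - b \in T |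
      [&& z - b \in T, q < d & d <= p + q]]) T) T) T.
  by case: X; vm_compute.
move=> aT zT bT d0 D0 p0 q0 Dpq e1 e2.
have [d [p' [q' [ed ep eq [dd dp dq e3 e4]]]]] := vdet_ratio D0 p0 q0 e1 e2 d0.
have /= := allP (allP (allP H _ aT) _ zT) _ bT.
rewrite -ed -ep -eq dd dp dq /= => /implyP.
have -> : p' < d by nia.
move=> /(_ isT) /or3P[h|h|/and3P[h1 h2 h3]];
  [constructor 1|constructor 2|constructor 3] => //.
by split=> //; nia.
Qed.

End Tables.

Lemma heightD a b : height (a + b) = height a + height b.
Proof. rewrite /height /=; ring. Qed.

Lemma heightN a : height (- a) = - height a.
Proof. rewrite /height /=; ring. Qed.

Lemma between_sym a z b : between a z b -> between b z a.
Proof.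
move=> [D [p [q [D0 p0 q0 [e1 e2 e3]]]]]; exists D, q, p.
by split=> //; split; rewrite addrC.
Qed.

Lemma between_level a z b (D p q : int) :
  D * z.1.1 = p * a.1.1 + q * b.1.1 -> D * z.1.2 = p * a.1.2 + q * b.1.2 ->
  D * z.2 = p * a.2 + q * b.2 -> D * level z = p * level a + q * level b.
Proof.
move=> e1 e2 e3.
have -> : D * level z = 100 * (D * z.2) + (10 * (D * z.1.1) + D * z.1.2).
  by rewrite /level /height; ring.
by rewrite e1 e2 e3 /level /height; ring.
Qed.

Ltac lev :=
  repeat match goal with
    | H : context [level _] |- _ => revert H
    | H : context [height _] |- _ => revert H
  end;
  rewrite /level /= ?(heightD, heightN); lia.

(** * Sets of roots closed below a given level *)

Section ClosedBelow.
Variable X : rank2_type.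
Local Notation T := (coords X).

Definition pos_affine (x : vec * int) : bool := (x.1 \in T) && (0 < level x).

Local Notation affine := pos_affine.

Lemma level_inj x y : affine x -> affine y -> level x = level y -> x = y.
Proof.
move: x y => [c i] [d j] /andP[/= cT _] /andP[/= dT _].
have [c0 cb] := height_bound cT; have [d0 db] := height_bound dT.
rewrite /level /= => e.
have ij : i = j by lia.
by rewrite ij (height_inj cT dT) //; lia.
Qed.

(** The subsystem containing delta runs through c, c + delta, c + 2 delta, ... towards delta and
    then away from it through ..., -c + delta, -c. The witnesses come from (i + l)(c + j delta) = (j
    + l)(c + i delta) + (j - i)(-c + l delta), where i + l > 0 because the two levels add up to 100
    (i + l). *)
Lemma between_line (c d : vec) (i j l : int) : c \in T -> d = - c -> i < j ->
  0 < level (c, i) -> 0 < level (d, l) -> between (c, i) (c, j) (d, l).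
Proof.
move=> cT -> ij ci dl.
have [c0 cb] := height_bound cT.
have i0 : 0 <= i by move: ci; rewrite /level /=; lia.
have l0 : 0 <= l by move: dl; rewrite /level /= heightN; lia.
have il : 0 < i + l by move: ci dl; rewrite /level /= heightN; lia.
exists (i + l), (j + l), (j - i); split; try lia.
by split=> /=; ring.
Qed.

Definition closed_below (k : int) (P : vec * int -> Prop) : Prop :=
  forall a z b, affine a -> affine z -> affine b ->
  level a < k -> level z < k -> level b < k ->
  between a z b -> P a -> P b -> P z.

Section Rules.
Variables (k : int) (P : vec * int -> Prop) (Pcl : closed_below k P).

(** The levels of the summands add up to that of the sum, so only the sum has to be bounded by k. *)
Lemma closed_sum (c d e : vec) (i j l : int) : c \in T -> d \in T -> e \in T ->
  e = c + d -> l = i + j -> 0 < level (c, i) -> 0 < level (d, j) ->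
  level (e, l) < k -> P (c, i) -> P (d, j) -> P (e, l).
Proof.
move=> cT dT eT ee el ci dj; subst e l.
have E : level (c + d, i + j) = level (c, i) + level (d, j).
  by rewrite /level /= heightD; lia.
rewrite E => lk; apply: Pcl; rewrite /pos_affine ?E ?cT ?dT ?eT /=; try lia.
by exists 1, 1, 1; split=> //; split; rewrite !mul1r.
Qed.

Lemma closed_line (c d : vec) (i j l : int) : c \in T -> d = - c -> i < j ->
  0 < level (c, i) -> 0 < level (d, l) -> level (c, j) < k -> level (d, l) < k ->
  P (c, i) -> P (d, l) -> P (c, j).
Proof.
move=> cT dc ij ci dl jk lk; have bt := between_line cT dc ij ci dl; subst d.
by apply: Pcl bt; rewrite /pos_affine /= ?cT ?coordsN //;
  move: ci jk; rewrite /level /=; lia.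
Qed.

End Rules.

(** * Conflicts between rank 2 subsystems *)

Section Conflict.
Variables (k : int) (P : vec * int -> Prop).
Hypotheses (Pcl : closed_below k P) (Ncl : closed_below k (fun r => ~ P r)).

(** All roots here have level below k. Since x + i' delta lies between x + i delta and any -x + l
    delta, every -x + l delta is out; dually, every -y + l delta is in. Then x + y + m delta is out,
    because adding a member to it gives x + i' delta; but adding a nonmember to it gives y + j
    delta, which is in. *)
Lemma parallelogram (x y : vec) (i j i' j' : int) : x \in T -> y \in T -> x + y \in T ->
  0 < level (x, i) -> 0 < level (y, j) -> 0 < level (x, i') -> 0 < level (y, j') ->
  i + j = i' + j' -> level (x + y, i + j) <= k -> i < i' ->
  P (x, i) -> P (y, j) -> ~ P (x, i') -> ~ P (y, j') -> False.
Proof.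
move=> xT yT sT xi yj xi' yj' es sk ii' Px Py Nx Ny.
have [x0 xb] := height_bound xT; have [y0 yb] := height_bound yT.
have [s0 sb] := height_bound sT.
have [nxT nyT] := (coordsN xT, coordsN yT).
move: xi yj xi' yj' sk s0 sb; rewrite /level /= heightD => xi yj xi' yj' sk s0 sb.
have hN l : 0 < level (- x, l) -> level (- x, l) < k -> ~ P (- x, l).
{ move=> h1 h2 Pl; apply: Nx; apply: (closed_line Pcl xT erefl ii' _ h1 _ h2 Px Pl).
  all: lev. }
have hP l : 0 < level (- y, l) -> level (- y, l) < k -> P (- y, l).
{ move=> h1 h2; apply: contrapT => Pl.
  suff: ~ P (y, j) by [].
  apply: (closed_line Ncl yT erefl (_ : j' < j) _ h1 _ h2 Ny Pl).
  all: lev. }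
(* The least m for which x + y + m delta is positive; with it, -y + (i' - m) delta and -x + (j - m)
   delta are positive as well. *)
pose m : int := if 0 < height x + height y then 0 else 1.
have hm : m = 0 /\ 0 < height x + height y \/ m = 1 /\ height x + height y < 0.
  by rewrite /m; case: ifP; lia.
have Q : ~ P (x + y, m).
{ move=> Pm; apply: Nx; apply: (closed_sum Pcl sT nyT xT _ _ _ _ _ Pm (hP (i' - m) _ _)).
  - by rewrite addrK.
  all: lev. }
suff: ~ P (y, j) by [].
apply: (closed_sum Ncl sT nxT yT _ _ _ _ _ Q (hN (j - m) _ _)).
- by rewrite addrC addKr.
all: lev.
Qed.

(** The root x - u, or its opposite, joins both pairs: x = u + (x - u) forces it out, and then w =
    (x - u) + y is out as well. For the opposite root the same is done with y = w + (u - x) and u =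
    x + (u - x). *)
Lemma exchange (x y u w : vec) (i j i' j' : int) :
  x \in T -> y \in T -> u \in T -> w \in T ->
  x + y = u + w -> x - u \in T ->
  0 < level (x, i) -> 0 < level (y, j) -> 0 < level (u, i') -> 0 < level (w, j') ->
  i + j = i' + j' -> level (x + y, i + j) <= k ->
  ~ P (x, i) -> ~ P (y, j) -> P (u, i') -> P (w, j') -> False.
Proof.
move=> xT yT uT wT e vT xi yj ui wj es sk Nx Ny Pu Pw.
have ew : w = (x - u) + y by rewrite addrAC e addrC addKr.
have [v0 vb] := height_bound vT.
have eh : height x + height y = height u + height w by rewrite -!heightD e.
move: v0 vb sk xi yj ui wj; rewrite /level /= !heightD heightN => v0 vb sk xi yj ui wj.
(* One of two opposite affine roots with nonzero finite part is positive. *)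
have [vp|vn] : (0 < level (x - u, i - i')) \/ (0 < level (u - x, i' - i)).
- by rewrite /level /= !heightD !heightN; lia.
{ have Nv : ~ P (x - u, i - i').
  { move=> Pv; apply: Nx; apply: (closed_sum Pcl uT vT xT _ _ _ vp _ Pu Pv).
    - by rewrite addrCA subrr addr0.
    all: lev. }
  suff: ~ P (w, j') by [].
  apply: (closed_sum Ncl vT yT wT ew _ vp _ _ Nv Ny).
  all: lev. }
have v'T : u - x \in T by rewrite -opprB coordsN.
have Nv : ~ P (u - x, i' - i).
{ move=> Pv; apply: Ny; apply: (closed_sum Pcl wT v'T yT _ _ _ vn _ Pw Pv).
  - by rewrite ew -(opprB u x) addrAC addNr add0r.
  all: lev. }
suff: ~ P (u, i') by [].
apply: (closed_sum Ncl xT v'T uT _ _ _ vn _ Nx Nv).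
- by rewrite addrCA subrr addr0.
all: lev.
Qed.

Lemma sum_conflict (x y u w : vec) (i j i' j' : int) :
  x \in T -> y \in T -> u \in T -> w \in T ->
  x + y \in T -> x + y = u + w ->
  0 < level (x, i) -> 0 < level (y, j) -> 0 < level (u, i') -> 0 < level (w, j') ->
  i + j = i' + j' -> level (x + y, i + j) <= k ->
  ~ P (x, i) -> ~ P (y, j) -> P (u, i') -> P (w, j') -> False.
Proof.
move=> xT yT uT wT sT e xi yj ui wj es sk Nx Ny Pu Pw.
have same (x' y' : vec) (a b a' b' : int) : x' \in T -> y' \in T -> x' + y' \in T ->
  0 < level (x', a) -> 0 < level (y', b) -> 0 < level (x', a') -> 0 < level (y', b') ->
  a + b = a' + b' -> level (x' + y', a + b) <= k ->
  ~ P (x', a) -> ~ P (y', b) -> P (x', a') -> P (y', b') -> False.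
  move=> x'T y'T s'T xa yb xa' yb' es' s'k Nx' Ny' Px' Py'.
  (* If a < a', then b' < b, and the summands exchange their roles; if a = a', one root is both in
     and out. *)
  case: (ltgtP a' a) => aa.
  - by apply: (parallelogram x'T y'T s'T xa' yb' xa yb) => //; rewrite -es'.
  - apply: (@parallelogram y' x' b' a' b a) => //; rewrite ?(addrC y') //; lev.
  - by apply: Nx'; rewrite -aa.
have [ux|uy|v|v] := sum_exchange xT yT uT wT sT e.
- have wy : w = y by apply: (addrI x); rewrite -{1}ux -e.
  by subst u w; apply: (same x y i j i' j').
- have wx : w = x by apply: (addrI y); rewrite -{1}uy -e addrC.
  by subst u w; apply: (same x y i j j' i') => //; lia.
- exact: (exchange xT yT uT wT e v xi yj ui wj es sk).
apply: (exchange yT xT uT wT _ v yj xi ui wj _ _ Ny Nx Pu Pw).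
- by rewrite addrC.
- by rewrite addrC es.
- by rewrite (addrC y) (addrC j).
Qed.

End Conflict.
End ClosedBelow.

(** * Conflicts with the subsystem containing delta *)

Section LineConflict.
Variables (X : rank2_type) (k : int) (P : vec * int -> Prop).
Local Notation T := (coords X).
Hypotheses (Pcl : closed_below X k P) (Ncl : closed_below X k (fun r => ~ P r)).

(* The largest m such that - c + m delta has smaller level than c + n delta: the
   neighbour of c + n delta on the other side of delta. *)
Definition opp_top (c : vec) (n : int) : int := if 0 < height c then n else n - 1.

Lemma opp_topP c n : c \in T ->
  (opp_top c n = n /\ 0 < height c) \/ (opp_top c n = n - 1 /\ height c < 0).
Proof. by move/height_bound => [c0 _]; rewrite /opp_top; case: ifP; lia. Qed.

Section OneSided.
Variables (x y : vec) (i j : int).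
Hypotheses (xT : x \in T) (yT : y \in T) (sT : x + y \in T).
Hypotheses (xi : 0 < level (x, i)) (yj : 0 < level (y, j)).
Hypotheses (sk : level (x + y, i + j) = k) (s1 : 0 < level (x + y, i + j - 1)).
Hypotheses (Nx : ~ P (x, i)) (Ny : ~ P (y, j)) (Ps : P (x + y, i + j - 1)).
Hypothesis (Pt : P (- (x + y), opp_top (x + y) (i + j))).

(** Were x + (i - 1) delta out, its sum with y + j delta would be out, against [Ps]. So it is in,
    and since x + i delta lies between it and any -x + l delta, the latter must be out. *)
Lemma lower_summand : 0 < level (x, i - 1) ->
  forall l, 0 < level (- x, l) -> level (- x, l) < k -> ~ P (- x, l).
Proof.
move=> x1; have Px1 : P (x, i - 1).
{ apply: contrapT => Nx1; suff: ~ P (x + y, i + j - 1) by [].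
  apply: (closed_sum Ncl xT yT sT erefl _ x1 _ _ Nx1 Ny); lev. }
move=> l h1 h2 Pl; apply: Nx.
apply: (closed_line Pcl xT erefl _ x1 h1 _ h2 Px1 Pl); lev.
Qed.

(** The upper neighbour on the opposite side of delta is in, so it is not a sum of two
    nonmembers. *)
Lemma opp_split (k1 k2 : int) : k1 + k2 = opp_top (x + y) (i + j) ->
  0 < level (- x, k1) -> 0 < level (- y, k2) -> ~ P (- x, k1) -> ~ P (- y, k2) -> False.
Proof.
have [x0 xb] := height_bound xT; have [y0 yb] := height_bound yT.
have [s0 sb] := height_bound sT; move: s0 sb; rewrite heightD => s0 sb.
have nT := (coordsN xT, coordsN yT, coordsN sT).
move=> ek h1 h2 N1 N2; suff: ~ P (- (x + y), opp_top (x + y) (i + j)) by [].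
apply: (closed_sum Ncl _ _ _ _ _ h1 h2 _ N1 N2); rewrite ?nT //; first by rewrite opprD.
have [[e s]|[e s]] := opp_topP (i + j) sT; rewrite e; lev.
Qed.

End OneSided.

Lemma line_conflict (x y : vec) (i j : int) : x \in T -> y \in T -> x + y \in T ->
  0 < level (x, i) -> 0 < level (y, j) ->
  level (x + y, i + j) = k -> 0 < level (x + y, i + j - 1) ->
  ~ P (x, i) -> ~ P (y, j) -> P (x + y, i + j - 1) ->
  P (- (x + y), opp_top (x + y) (i + j)) -> False.
Proof.
(* Up to exchanging x and y, nothing else can occur: if neither root can be lowered by delta and
   both heights are positive, then i = j = 0, and x + y + (i + j - 1) delta is not positive. *)
wlog h : x y i j / 0 < level (y, j - 1) \/
    [/\ level (x, i - 1) <= 0, level (y, j - 1) <= 0 & height x < 0].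
  move=> W xT yT sT xi yj sk s1 Nx Ny Ps Pt.
  have W' : (0 < level (x, i - 1) \/
    [/\ level (y, j - 1) <= 0, level (x, i - 1) <= 0 & height y < 0]) -> False.
    move=> h; apply: (W y x j i) => //; rewrite ?(addrC y) ?(addrC j) //.
  have [x0 xb] := height_bound xT; have [y0 yb] := height_bound yT.
  case: (ltP 0 (level (y, j - 1))) => hy; first by apply: (W x y i j) => //; left.
  case: (ltP 0 (level (x, i - 1))) => hx; first by apply: W'; left.
  case: (ltP (height x) 0) => hx0; first by apply: (W x y i j) => //; right.
  case: (ltP (height y) 0) => hy0; first by apply: W'; right.
  lev.
move=> xT yT sT xi yj sk s1 Nx Ny Ps Pt.
have [x0 xb] := height_bound xT; have [y0 yb] := height_bound yT.
have [s0 sb] := height_bound sT; move: s0 sb; rewrite heightD => s0 sb.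
have [nxT nyT] := (coordsN xT, coordsN yT).
have nsT := coordsN sT.
have := opp_topP (i + j) sT; rewrite heightD => top.
have LX := @lower_summand x y i j xT yT sT xi yj sk s1 Nx Ny Ps.
have LY : 0 < level (y, j - 1) ->
    forall l, 0 < level (- y, l) -> level (- y, l) < k -> ~ P (- y, l).
  by apply: (@lower_summand y x j i yT xT _ yj xi _ _ Ny Nx); rewrite ?(addrC y) ?(addrC j).
have SP k1 k2 := @opp_split x y i j xT yT sT xi yj sk s1 Pt k1 k2.
have eyx : y = x + y + - x by rewrite addrC addKr.
have exy : x = x + y + - y by rewrite addrK.
case: h => [y1|[hx hy x_lt0]].
{ have {}LY := LY y1.
  case: (ltP 0 (level (x, i - 1))) => x1.
  { have {}LX := LX x1.
    (* Here k2 is the least index for which -y + k2 delta is positive. *)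
    have [k2 [h1 h2]] : exists k2 : int, 0 < level (- y, k2) /\
        0 < level (- x, opp_top (x + y) (i + j) - k2).
    { case: (ltP 0 (height y)) => hy; [exists 1|exists 0]; lev. }
    apply: (SP _ k2 _ h2 h1); first by rewrite subrK.
    - apply: LX => //; lev.
    - apply: LY => //; lev. }
  suff Px : P (- x, 1 - i).
  { apply: Ny; apply: (closed_sum Pcl sT nxT yT eyx _ s1 _ _ Ps Px); lev. }
  apply: contrapT => Nx1.
  case: (ltP 0 (level (- y, opp_top (x + y) (i + j) - (1 - i)))) => h.
  { apply: (SP (1 - i) _ _ _ h Nx1); first by rewrite addrC subrK.
    - lev.
    - apply: LY => //; lev. }
  (* Only i = 0, j = 1 with x and y of positive height is left. Then [opp_top] is 1, and -x + delta
     is the sum of y and -(x + y) + delta. *)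
  have Py1 : P (y, j - 1).
  { apply: contrapT => Ny1; suff: ~ P (x + y, i + j - 1) by [].
    apply: (closed_sum Ncl xT yT sT erefl _ xi y1 _ Nx Ny1); lev. }
  apply: Nx1; apply: (closed_sum Pcl yT nsT nxT _ _ y1 _ _ Py1 Pt).
  - by rewrite opprD addrCA subrr addr0.
  all: lev. }
(* Now i = 1, and j is 0 or 1 according to the sign of y. In both cases [opp_top (x + y) (i + j)] is
   1. *)
have Nx0 : ~ P (- x, 0).
{ move=> Px; apply: Ny; apply: (closed_sum Pcl sT nxT yT eyx _ s1 _ _ Ps Px); lev. }
have Py1 : P (- y, 1).
{ apply: contrapT => Ny1; apply: (SP 0 1 _ _ _ Nx0 Ny1); lev. }
case: (ltP 0 (height y)) => y_gt0.
{ apply: Nx; apply: (closed_sum Pcl sT nyT xT exy _ s1 _ _ Ps Py1); lev. }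
have Ny0 : ~ P (- y, 0).
{ move=> Py; apply: Nx; apply: (closed_sum Pcl sT nyT xT exy _ s1 _ _ Ps Py); lev. }
suff: ~ P (- y, 1) by [].
apply: (closed_line Ncl nyT _ (_ : 0 < 1) _ yj _ _ Ny0 Ny); rewrite ?opprK //; lev.
Qed.

End LineConflict.

(** * Closures of coclosed sets *)

Section Induction.
Variable X : rank2_type.
Local Notation T := (coords X).
Local Notation affine := (pos_affine X).

Lemma parallel_scale (a b : vec) (D p : int) : a \in T -> b \in T -> D != 0 ->
  D * b.1 = p * a.1 -> D * b.2 = p * a.2 ->
  (b = a /\ p = D) \/ (b = - a /\ p = - D).
Proof.
move=> aT bT D0 e1 e2.
have d0 : vdet a b = 0.
  apply: (mulfI D0); rewrite mulr0 /vdet mulrBr.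
  have -> : D * (a.1 * b.2) = a.1 * (D * b.2) by ring.
  have -> : D * (a.2 * b.1) = a.2 * (D * b.1) by ring.
  by rewrite e1 e2; ring.
have [a0 _] := height_bound aT.
have eh : D * height b = p * height a.
  have -> : D * height b = 10 * (D * b.1) + D * b.2 by rewrite /height; ring.
  by rewrite e1 e2 /height; ring.
have [eb|eb] := vdet_eq0 aT bT d0; [left|right]; split=> //; apply: (mulIf a0).
  by rewrite -eh eb.
by rewrite -eh eb heightN mulNr mulrN.
Qed.

(** D (z - a) = (p - D) a + q b. If p = D, then z - a is a positive multiple of b, hence b itself;
    otherwise it lies between a and b. *)
Lemma subtract_closed k P (a z b : vec * int) (D p q : int) :
  closed_below X k P -> affine a -> affine z -> affine b -> k = level z ->
  level a < k -> level b < k -> 0 < D -> 0 < p -> 0 < q ->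
  D * z.1.1 = p * a.1.1 + q * b.1.1 -> D * z.1.2 = p * a.1.2 + q * b.1.2 ->
  D * z.2 = p * a.2 + q * b.2 ->
  D <= p -> z.1 - a.1 \in T -> P a -> P b -> P (z.1 - a.1, z.2 - a.2).
Proof.
move: a z b => [a i] [z n] [b j] /= Pcl aA zA bA ek ak bk D0 p0 q0 e1 e2 e3 Dp dT Pa Pb.
move: (aA) (zA) (bA) => /andP[/= aT a0] /andP[/= zT z0] /andP[/= bT b0].
have dA : affine (z - a, n - i) by rewrite /pos_affine dT /=; lev.
have {Dp} [Dp|Dp] : D = p \/ D < p by lia.
  subst p; have [] := @parallel_scale b (z - a) D q bT dT.
  - by lia.
  - by rewrite /= mulrDr mulrN e1 addrAC subrr add0r.
  - by rewrite /= mulrDr mulrN e2 addrAC subrr add0r.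
  - move=> [-> qD]; have -> : n - i = j; last by [].
    apply: (@mulfI _ D); first lia.
    by rewrite mulrBr e3 qD addrAC subrr add0r.
  - by lia.
apply: (Pcl (a, i) _ (b, j)) => //; first by lev.
exists D, (p - D), q; split=> //; first lia.
by split=> /=; rewrite mulrDr mulrN ?e1 ?e2 ?e3; ring.
Qed.

(* P holds at both neighbours of z among the earlier roots of some rank 2
   subsystem; the second case is the subsystem containing delta. *)
Definition neighbours (P : vec * int -> Prop) (z : vec * int) : Prop :=
  (exists x y i j, [/\ x \in T, y \in T, z = (x + y, i + j) &
     [/\ 0 < level (x, i), 0 < level (y, j), P (x, i) & P (y, j)]]) \/
  [/\ 0 < level (z.1, z.2 - 1), P (z.1, z.2 - 1) & P (- z.1, opp_top z.1 z.2)].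

(** Away from delta, a or b can be subtracted from z, and the difference is again in P. In the
    subsystem of delta, a and b lie on opposite sides, and P spreads along each side up to the
    neighbour of z. *)
Lemma middle_neighbours P a z b : closed_below X (level z) P ->
  affine a -> affine z -> affine b -> level a < level z -> level b < level z ->
  between a z b -> P a -> P b -> neighbours P z.
Proof.
move=> Pcl aA zA bA az bz [D [p [q [D0 p0 q0 [e1 e2 e3]]]]] Pa Pb.
have eL := between_level e1 e2 e3.
have Dpq : D < p + q.
  have /andP[_ z0] := zA.
  by rewrite -(ltr_pM2r z0) eL mulrDl ltrD // ltr_pM2l.
move: a z b eL Pcl aA zA bA az bz e1 e2 e3 Pa Pb => [a i] [z n] [b j] /= eL.
move=> Pcl aA zA bA az bz e1 e2 e3 Pa Pb.
move: (aA) (zA) (bA) => /andP[/= aT a0] /andP[/= zT z0] /andP[/= bT b0].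
have [ha hb] := (height_bound aT, height_bound bT); have hz := height_bound zT.
have [d0|d0] := eqVneq (vdet a b) 0; last first.
  left; have [[Dp dT]|[Dq dT]] := decompose_middle aT zT bT d0 D0 p0 q0 Dpq e1 e2.
    have := subtract_closed Pcl aA zA bA erefl az bz D0 p0 q0 e1 e2 e3 Dp dT Pa Pb.
    move=> /= Pd; exists a, (z - a), i, (n - i).
    by split=> //; [rewrite !(addrC _ (_ - _)) !subrK|split=> //; lev].
  rewrite addrC in e1; rewrite addrC in e2; rewrite addrC in e3.
  have := subtract_closed Pcl bA zA aA erefl bz az D0 q0 p0 e1 e2 e3 Dq dT Pb Pa.
  move=> /= Pd; exists b, (z - b), j, (n - j).
  by split=> //; [rewrite !(addrC _ (_ - _)) !subrK|split=> //; lev].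
have [eb|eb] := vdet_eq0 aT bT d0.
  exfalso; subst b; have [] := @parallel_scale a z D (p + q) aT zT.
  - by lia.
  - by rewrite e1; ring.
  - by rewrite e2; ring.
  - by case; lia.
  - by case; lia.
right.
(* Whichever of a and b has the finite part of z plays the role of c; the other one plays that of
   c'. *)
have key c c' l l' : z = c -> c' = - c -> 0 < level (c, l) -> 0 < level (c', l') ->
  level (c, l) < level (z, n) -> level (c', l') < level (z, n) ->
  P (c, l) -> P (c', l') ->
  [/\ 0 < level (z, n - 1), P (z, n - 1) & P (- z, opp_top z n)].
  move=> <- -> {c c'} c0 c'0 cz c'z Pc Pc'.
  have top := opp_topP n zT.
  split; first by lev.
    have [->//|ln] : n - 1 = l \/ l < n - 1 by lev.
    by apply: (closed_line Pcl zT erefl ln) Pc Pc' => //; lev.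
  have [->//|ln] : opp_top z n = l' \/ l' < opp_top z n by lev.
  apply: (closed_line Pcl (coordsN zT) _ ln) Pc' Pc; rewrite ?opprK //; lev.
have [|||[za _]|[za _]] := @parallel_scale a z D (p - q) aT zT.
- by lia.
- by rewrite e1 eb /=; ring.
- by rewrite e2 eb /=; ring.
- exact: (key a b i j).
by apply: (key b a j i) => //; rewrite ?za ?eb ?opprK.
Qed.

Lemma closed_belowNN k P : closed_below X k P ->
  closed_below X k (fun r => ~ ~ P r).
Proof.
move=> Pcl a z b aA zA bA ak zk bk abz /contrapT Pa /contrapT Pb Nz.
by apply: Nz; apply: Pcl abz Pa Pb.
Qed.

Lemma neighbours_conflict P z : closed_below X (level z) P ->
  closed_below X (level z) (fun r => ~ P r) -> affine z ->
  neighbours P z -> neighbours (fun r => ~ P r) z -> False.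
Proof.
move=> Pcl Ncl /andP[zT _].
have NNcl := closed_belowNN Pcl.
move=> [[x [y [i [j [xT yT ez [x0 y0 Px Py]]]]]]|[z1 P1 P2]]; last first.
  move=> [[u [w [i' [j' [uT wT ez [u0 w0 Nu Nw]]]]]]|[_ N1 _]]; last by [].
  subst z; exact: (line_conflict Pcl Ncl uT wT zT u0 w0 erefl z1 Nu Nw P1 P2).
subst z; rewrite /= in zT.
move=> [[u [w [i' [j' [uT wT ez [u0 w0 Nu Nw]]]]]]|[/= z1 N1 N2]].
  have e : x + y = u + w := congr1 fst ez.
  have ei : i + j = i' + j' := congr1 snd ez.
  apply: (sum_conflict Pcl Ncl uT wT xT yT) Nu Nw Px Py => //; by rewrite -?e -?ei.
exact: (line_conflict Ncl NNcl xT yT zT x0 y0 erefl z1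
  (fun h => h Px) (fun h => h Py) N1 N2).
Qed.

(** The last root a is not extreme: an earlier root e lies beyond it, and the rank 2 subsystem is
    traversed in the order e, a, z, b. When the finite parts of a and b are independent, e is a - z,
    a - b or z - b. *)
Lemma before_end (a z b : vec * int) : affine a -> affine z -> affine b ->
  level z < level a -> level b < level a -> between a z b ->
  exists e, [/\ affine e, level e < level a, between e a z & between e z b].
Proof.
move: a z b => [a i] [z n] [b j] aA zA bA za ba [D [p [q [D0 p0 q0 /= [e1 e2 e3]]]]].
have eL := @between_level (a, i) (z, n) (b, j) D p q e1 e2 e3.
move: (aA) (zA) (bA) => /andP[/= aT a0] /andP[/= zT z0] /andP[/= bT b0].
have qb : 0 < q * level (b, j) by rewrite mulr_gt0.
have pD : p < D.
  rewrite ltNge; apply/negP => Dp.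
  have h1 : D * level (z, n) < D * level (a, i) by rewrite ltr_pM2l.
  have h2 : D * level (a, i) <= p * level (a, i) by rewrite ler_pM2r.
  lia.
have [ha ha'] := height_bound aT; have [hz hz'] := height_bound zT.
have [hb hb'] := height_bound bT.
have [d0|d0] := eqVneq (vdet a b) 0; last first.
  have [dT|dT|[dT qD Dpq]] := decompose_end aT zT bT d0 D0 p0 q0 pD e1 e2.
  - exists (a - z, i - n); rewrite /pos_affine dT /=; split; try lev.
      by exists 1, 1, 1; split=> //; split=> /=; ring.
    exists (D - p), p, q; split; try lia.
    by split; rewrite /= mulrBl ?e1 ?e2 ?e3; ring.
  - exists (a - b, i - j); rewrite /pos_affine dT /=; split; try lev.
      exists (p + q), q, D; split; try lia.
      by split; rewrite /= ?e1 ?e2 ?e3; ring.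
    exists D, p, (p + q); split; try lia.
    by split; rewrite /= ?e1 ?e2 ?e3; ring.
  have zb : level (b, j) < level (z, n).
    rewrite -(ltr_pM2l q0); apply: (@le_lt_trans _ _ (D * level (z, n) - p * level (a, i))).
      by rewrite eL addrAC subrr add0r.
    apply: (@lt_le_trans _ _ ((D - p) * level (z, n))).
      by rewrite mulrBl ltrD2l ltrN2 ltr_pM2l.
    by rewrite ler_pM2r // lerBlDr addrC.
  exists (z - b, n - j); rewrite /pos_affine dT /=; split; try lev.
    exists p, q, (D - q); split; try lia.
    by split; rewrite /= mulrBl ?e1 ?e2 ?e3; ring.
  by exists 1, 1, 1; split=> //; split=> /=; ring.
have [eb|eb] := vdet_eq0 aT bT d0; subst b.
  have [|||[ez Dpq]|[_]] := @parallel_scale a z D (p + q) aT zT; try lia.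
  subst z; have ij : j < i by lev.
  have ni : n < i by lev.
  have jn : j < n.
    rewrite -(ltr_pM2l D0) e3 -Dpq mulrDl ltrD2r ltr_pM2l //.
  (* The lowest positive root on the other side of delta. It precedes a because j < n < i. *)
  pose m : int := if 0 < height a then 1 else 0.
  have m0 : 0 < level (- a, m) by rewrite /m; case: ifP; lev.
  exists (- a, m); split.
  - by rewrite /pos_affine /= coordsN.
  - by move: m0; rewrite /m; case: ifP; lev.
  - by apply: between_sym; apply: (between_line aT).
  - by apply: between_sym; apply: (between_line aT).
have [|||[_]|[ez Dpq]] := @parallel_scale a z D (p - q) aT zT; try lia.
- by rewrite e1 /=; ring.
- by rewrite e2 /=; ring.
subst z; have qDp : q = D + p by lia.
have i0 : 0 <= i by lev.
have j0 : 0 <= j by lev.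
have ij : 0 < i + j by lev.
have jn : j < n.
  rewrite -(ltr_pM2l D0) e3 qDp mulrDl addrCA -mulrDr ltrDl mulr_gt0 //.
(* Since 0 <= j < n and z precedes a, the index i is large enough to be lowered. *)
have i1 : 0 < level (a, i - 1) by lev.
exists (a, i - 1); split.
- by rewrite /pos_affine /= aT.
- by lev.
- by apply: (between_line aT) => //; lia.
- by apply/between_sym/(between_line zT); rewrite ?opprK.
Qed.

Lemma between_diag a z : affine a -> affine z -> between a z a -> z = a.
Proof.
move: a z => [a i] [z n] /andP[/= aT _] /andP[/= zT _].
move=> [D [p [q [D0 p0 q0 /= [e1 e2 e3]]]]].
have [|||[ez Dpq]|[_]] := @parallel_scale a z D (p + q) aT zT; try lia.
congr pair => //; apply: (@mulfI _ D); first lia.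
by rewrite e3 -Dpq mulrDl.
Qed.

Variable S : vec * int -> Prop.
Hypothesis S_coclosed : forall a z b, affine a -> affine z -> affine b ->
  between a z b -> S z -> S a \/ S b.

Inductive generated : vec * int -> Prop :=
| Generator x : S x -> generated x
| Generate a z b : affine a -> affine z -> affine b ->
    level a < level z -> level b < level z -> between a z b ->
    generated a -> generated b -> generated z.

Local Notation C := generated.

Definition biclosed_below (k : int) : Prop :=
  closed_below X k C /\ closed_below X k (fun r => ~ C r).

(** If z came from S, coclosedness puts a or b in S. If z was generated from c and d, the neighbours
    of z in their subsystem are in, while those in the subsystem of a and b are out: a conflict. *)
Lemma generated_middle a z b : biclosed_below (level z) ->
  affine a -> affine z -> affine b -> level a < level z -> level b < level z ->
  between a z b -> ~ C a -> ~ C b -> ~ C z.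
Proof.
move=> [Pcl Ncl] aA zA bA az bz abz Na Nb Cz.
have Nn := middle_neighbours Ncl aA zA bA az bz abz Na Nb.
case: Cz Pcl Ncl aA zA bA az bz abz Nn => [{}z Sz|c {}z d cA _ dA cz dz cdz Cc Cd].
  move=> _ _ aA zA bA _ _ abz _.
  by case: (S_coclosed aA zA bA abz Sz) => h; [apply: Na|apply: Nb]; apply: Generator.
move=> Pcl Ncl _ zA _ _ _ _ Nn.
exact: (neighbours_conflict Pcl Ncl zA
  (middle_neighbours Pcl cA zA dA cz dz cdz Cc Cd) Nn).
Qed.

(** With e beyond a: if a and b are in but z is out, then e is in because a lies between e and z,
    and so z is in because it lies between e and b. If a and b are out but z is in, then e is in
    because z lies between e and b, and a is generated from e and z. *)
Lemma generated_end a z b : biclosed_below (level a) ->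
  affine a -> affine z -> affine b -> level z < level a -> level b < level a ->
  between a z b -> (C a -> C b -> C z) /\ (~ C a -> ~ C b -> ~ C z).
Proof.
move=> bc aA zA bA za ba abz; have [Pcl Ncl] := bc.
have [e [eA ea eaz ezb]] := before_end aA zA bA za ba abz.
split=> [Ca Cb|Na Nb Cz].
  apply: contrapT => Nz.
  have Ce : C e.
    by apply: contrapT => Ne; apply: (generated_middle bc eA aA zA ea za eaz Ne Nz).
  by apply: Nz; apply: Pcl ezb Ce Cb.
have Ce : C e.
  by apply: contrapT => Ne; apply: (Ncl _ _ _ eA zA bA ea za ba ezb Ne Nb).
by apply: Na; apply: Generate eaz Ce Cz.
Qed.

Lemma generated_biclosed_below (n : nat) : biclosed_below n%:Z.
Proof.
elim: n => [|n IH].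
  by split=> a z b /andP[_ a0] _ _ an; lia.
have cases a z b : affine a -> affine z -> affine b -> level a < n.+1%:Z ->
    level z < n.+1%:Z -> level b < n.+1%:Z -> between a z b ->
    (C a -> C b -> C z) /\ (~ C a -> ~ C b -> ~ C z).
  move=> aA zA bA an zn bn abz; have [Pcl Ncl] := IH.
  (* At most one root has level n. If two of a, z, b have it, they coincide and the claim is
     trivial; otherwise the new root is z, a or b alone. *)
  have [ez|zn'] := eqVneq (level z) n%:Z.
    have [ea|an'] := eqVneq (level a) n%:Z.
      by rewrite (level_inj zA aA) // ez ea.
    have [eb|bn'] := eqVneq (level b) n%:Z.
      by rewrite (level_inj zA bA) // ez eb.
    have az : level a < level z by lia.
    have bz : level b < level z by lia.
    split; first exact: Generate.
    by apply: generated_middle => //; rewrite ez.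
  have zn1 : level z < n%:Z by lia.
  have [ea|an'] := eqVneq (level a) n%:Z.
    have [eb|bn'] := eqVneq (level b) n%:Z.
      have ab : a = b by apply: (level_inj aA bA); rewrite ea eb.
      by subst b; rewrite (between_diag aA zA abz).
    by apply: generated_end => //; rewrite ?ea //; lia.
  have [eb|bn'] := eqVneq (level b) n%:Z.
    have [] // := @generated_end b z a _ bA zA aA _ _ (between_sym abz);
      rewrite ?eb //; first lia.
    by move=> h1 h2; split=> h3 h4; [apply: h1|apply: h2].
  by split; [apply: (Pcl a z b)|apply: (Ncl a z b)] => //; lia.
by split=> a z b aA zA bA an zn bn abz; have [] := cases a z b aA zA bA an zn bn abz.
Qed.

Lemma generated_biclosed a z b : affine a -> affine z -> affine b -> between a z b ->
  (C a -> C b -> C z) /\ (~ C a -> ~ C b -> ~ C z).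
Proof.
move=> aA zA bA abz.
have [Pcl Ncl] := generated_biclosed_below (`|level a| + `|level z| + `|level b|).+1%N.
by split; [apply: (Pcl a z b)|apply: (Ncl a z b)] => //; lia.
Qed.

End Induction.

(** * Coordinates of the given root system *)

Section RootCoordinates.
Context {R : realType} {V : vectType R} (ip : {dot V for idfun}).
Variables (Phi : seq V) (Pi : 2.-tuple V) (X : rank2_type) (s : 'S_2).
Hypotheses (hPhi : root_system ip Phi) (hred : reduced Phi).
Hypothesis hPi : simple_system Phi Pi.
Hypothesis hs : forall i j : 'I_2,
  cartan_number ip (tnth Pi (s i)) (tnth Pi (s j)) = (cartan_matrix X i j)%:~R.

(** The permutation [s] puts the simple roots in the order of [cartan_matrix], so that x and y match
    the tables. *)
Definition comb (x y : R) : V := x *: tnth Pi (s 0) + y *: tnth Pi (s 1).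

Lemma comb_coord v : v = comb (coord Pi (s 0) v) (coord Pi (s 1) v).
Proof.
rewrite {1}(coord_basis (simple_basis hPi) (memvf v)).
rewrite (reindex_inj (@perm_inj _ s)) /= !big_ord_recl big_ord0 addr0.
have -> : ord0 = 0 :> 'I_2 by apply: val_inj.
have -> : lift 0 ord0 = 1 :> 'I_2 by apply: val_inj.
by rewrite /comb !(tnth_nth 0).
Qed.

Lemma coord_comb x y : coord Pi (s 0) (comb x y) = x /\ coord Pi (s 1) (comb x y) = y.
Proof.
have Pf := basis_free (simple_basis hPi).
rewrite /comb !linearD !linearZ /= !(tnth_nth 0) !coord_free //.
by rewrite !(inj_eq (@perm_inj _ s)) /= !mulr1 !mulr0 addr0 add0r.
Qed.

Lemma comb_inj x y x' y' : comb x y = comb x' y' -> x = x' /\ y = y'.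
Proof.
move=> e; have [ex ey] := coord_comb x y; have [ex' ey'] := coord_comb x' y'.
by split; [rewrite -ex e|rewrite -ey e].
Qed.

Lemma root_sign x y : comb x y \in Phi ->
  (0 <= x /\ 0 <= y) \/ (x <= 0 /\ y <= 0).
Proof.
move=> vPhi; have [ex ey] := coord_comb x y.
case/orP: (simple_sign hPi vPhi) => /=/andP[_ /forallP h]; [left|right].
  by split; [rewrite -ex|rewrite -ey]; apply: h.
split; [rewrite -ex|rewrite -ey]; rewrite -oppr_ge0 -linearN; exact: h.
Qed.

Lemma cartan_numberD (x y : R) u v w :
  cartan_number ip (x *: u + y *: v) w = x * cartan_number ip u w + y * cartan_number ip v w.
Proof.
rewrite /cartan_number linearDl !linearZl_LR /=.
by ring.
Qed.

Definition c12 : int := cartan_matrix X 0 1.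
Definition c21 : int := cartan_matrix X 1 0.

Lemma cartan_diag i : cartan_matrix X i i = 2.
Proof. by rewrite mxE eqxx. Qed.

Lemma simple_tnth i : tnth Pi i \in Phi.
Proof. by apply: (simple_root hPi); apply: mem_tnth. Qed.

Lemma reflect_simple0 x y : comb x y \in Phi -> comb (- x - c21%:~R * y) y \in Phi.
Proof.
move=> vPhi; have := root_reflection hPhi vPhi (simple_tnth (s 0)).
rewrite /reflection {2}/comb cartan_numberD !hs cartan_diag.
rewrite /comb addrAC -scalerBl; set r := x - _.
by have -> : r = - x - c21%:~R * y by rewrite /r /c21; ring.
Qed.

Lemma reflect_simple1 x y : comb x y \in Phi -> comb x (- y - c12%:~R * x) \in Phi.
Proof.
move=> vPhi; have := root_reflection hPhi vPhi (simple_tnth (s 1)).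
rewrite /reflection {2}/comb cartan_numberD !hs cartan_diag.
rewrite /comb -addrA -scalerBl; set r := y - _.
by have -> : r = - y - c12%:~R * x by rewrite /r /c12; ring.
Qed.

Definition comb_vec (c : vec) : V := comb c.1%:~R c.2%:~R.

Lemma coords_root c : c \in coords X -> comb_vec c \in Phi.
Proof.
(* A step adjoins the images under both simple reflections; five steps from the simple roots reach
   the whole table in all three types. *)
pose step (l : seq vec) : seq vec :=
  l ++ [seq (- d.1 - c21 * d.2, d.2) | d <- l] ++ [seq (d.1, - d.2 - c12 * d.1) | d <- l].
have stepP l : {in l, forall d, comb_vec d \in Phi} ->
    {in step l, forall d, comb_vec d \in Phi}.
  move=> hl d; rewrite /step !mem_cat => /or3P[/hl//|/mapP[e /hl h ->]|/mapP[e /hl h ->]].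
    by have := reflect_simple0 h; rewrite /comb_vec /= rmorphB rmorphN rmorphM.
  by have := reflect_simple1 h; rewrite /comb_vec /= rmorphB rmorphN rmorphM.
have : {in iter 5 step [:: (1, 0); (0, 1)], forall d, comb_vec d \in Phi}.
  do 5! apply: (stepP _).
  move=> d; rewrite !inE => /orP[]/eqP->; rewrite /comb_vec /comb /=.
    by rewrite scale1r scale0r addr0 simple_tnth.
  by rewrite scale0r scale1r add0r simple_tnth.
have H : all (fun d => d \in iter 5 step [:: (1, 0); (0, 1)]) (coords X).
  rewrite /step /c12 /c21 !mxE /=.
  by case: X; vm_compute.
by move=> h cT; apply: h; apply: (allP H).
Qed.

Lemma root_opp v : v \in Phi -> - v \in Phi.
Proof.
move=> vPhi; have := root_reflection hPhi vPhi vPhi.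
have v0 : ip v v != 0.
  rewrite gt_eqF // neq0_dnorm_gt0 //; apply: contraNneq (root_neq0 hPhi) => <-.
  by [].
by rewrite /reflection /cartan_number mulfK // scaler_nat mulr2n opprD addrA subrr add0r.
Qed.

Lemma ray_root (c : vec) (t x y : R) : c \in coords X -> 0 <= t ->
  x = t * c.1%:~R -> y = t * c.2%:~R -> comb x y \in Phi -> comb x y = comb_vec c.
Proof.
move=> cT t0 -> -> vPhi.
have e : comb (t * c.1%:~R) (t * c.2%:~R) = t *: comb_vec c.
  by rewrite /comb_vec /comb scalerDr !scalerA.
rewrite e in vPhi *; have [->|tN] := hred (coords_root cT) vPhi; first by rewrite scale1r.
by move: t0; rewrite tN oppr_ge0 ler10.
Qed.

Lemma not_mixed x y : comb x y \in Phi -> ~ (0 < x /\ y < 0) /\ ~ (x < 0 /\ 0 < y).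
Proof. by move/root_sign => [[? ?]|[? ?]]; split=> -[? ?]; lra. Qed.

Lemma positive_root_coords (x y : R) : comb x y \in Phi -> 0 <= x -> 0 <= y ->
  exists2 c, c \in pos_coords X & comb x y = comb_vec c.
Proof.
move=> vPhi x0 y0.
suff [c cT [t t0 [ex ey]]] : exists2 c : vec, c \in pos_coords X &
    exists2 t : R, 0 <= t & x = t * c.1%:~R /\ y = t * c.2%:~R.
  by exists c => //; apply: (ray_root _ t0 ex ey vPhi); rewrite mem_cat cT.
(* A vector strictly between two adjacent roots is sent by one of these
   reflections to a vector with coordinates of opposite signs. *)
have [m2 _] := not_mixed (reflect_simple1 vPhi).
have v1 := reflect_simple0 vPhi; have [_ m3] := not_mixed v1.
have v2 := reflect_simple1 v1; have [m4 _] := not_mixed v2.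
have v3 := reflect_simple0 v2; have [_ m5] := not_mixed v3.
have v4 := reflect_simple1 v3; have [m6 _] := not_mixed v4.
have ray (c : vec) t : c \in pos_coords X -> 0 <= t -> x = t * c.1%:~R ->
    y = t * c.2%:~R -> exists2 c, c \in pos_coords X &
    exists2 t : R, 0 <= t & x = t * c.1%:~R /\ y = t * c.2%:~R.
  by move=> cT t0 ex ey; exists c => //; exists t.
have [x_eq0|x_neq0] := eqVneq x 0.
  apply: (ray (0, 1) y) => //=; rewrite ?mulr1 ?mulr0 //; by case: X.
have [y_eq0|y_neq0] := eqVneq y 0.
  apply: (ray (1, 0) x) => //=; rewrite ?mulr1 ?mulr0 //; by case: X.
have {x_neq0} x1 : 0 < x by rewrite lt0r x_neq0.
have {y_neq0} y1 : 0 < y by rewrite lt0r y_neq0.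
move: ray m2 m3 m4 m5 m6; rewrite /c12 /c21 !mxE /=.
case: X => /= ray m2 m3 m4 m5 m6.
- case: (ltgtP x y) => xy; last by apply: (ray (1, 1) x) => //=; rewrite ?mulr1.
    by exfalso; apply: m2; lra.
  by exfalso; apply: m3; lra.
- case: (ltgtP x y) => xy; last by apply: (ray (1, 1) x) => //=; rewrite ?mulr1.
    case: (ltgtP (2 * x) y) => xy2; last by apply: (ray (1, 2) x) => //=; lra.
      by exfalso; apply: m2; lra.
    by exfalso; apply: m4; lra.
  by exfalso; apply: m3; lra.
case: (ltgtP x (3 * y)) => h1; last by apply: (ray (3, 1) y) => //=; lra.
  case: (ltgtP x (2 * y)) => h2; last by apply: (ray (2, 1) y) => //=; lra.
    case: (ltgtP (2 * x) (3 * y)) => h3; last by apply: (ray (3, 2) (y / 2)) => //=; lra.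
      case: (ltgtP x y) => h4; last by apply: (ray (1, 1) y) => //=; lra.
        by exfalso; apply: m2; lra.
      by exfalso; apply: m6; lra.
    by exfalso; apply: m5; lra.
  by exfalso; apply: m4; lra.
by exfalso; apply: m3; lra.
Qed.

End RootCoordinates.

(** * The lattice of biclosed sets *)

Section BiclosedLattice.
Context {R : realType} {U : lmodType R} (Psi : set U).

Lemma biclosed_complement G : biclosed Psi G -> biclosed Psi (Psi `\` G).
Proof. by move=> [[GP Gcl] cG]; split; rewrite ?setDD ?(setIidr GP). Qed.

Lemma closed_in_set0 : closed_in Psi set0.
Proof. by split=> //; apply: sub0set. Qed.

Lemma closed_in_setT : closed_in Psi Psi.
Proof. by split. Qed.

Lemma biclosed_set0 : biclosed Psi set0.
Proof. by split; [exact: closed_in_set0|rewrite setD0; exact: closed_in_setT]. Qed.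

Lemma biclosed_setT : biclosed Psi Psi.
Proof. by split; [exact: closed_in_setT|rewrite setDv; exact: closed_in_set0]. Qed.

Definition mk_biclosed G (hG : biclosed Psi G) : biclosed_poset Psi :=
  exist _ G (mem_set hG).

Lemma biclosedP (G : biclosed_poset Psi) : biclosed Psi (val G).
Proof. exact: set_mem (valP G). Qed.

Definition bicompl (G : biclosed_poset Psi) : biclosed_poset Psi :=
  mk_biclosed (biclosed_complement (biclosedP G)).

Lemma bicomplK : involutive bicompl.
Proof.
move=> G; apply: val_inj; rewrite /= setDD setIidr //.
by have [[]] := biclosedP G.
Qed.

Lemma bicompl_anti (G H : biclosed_poset Psi) :
  (G <= H)%O -> (bicompl H <= bicompl G)%O.
Proof.
by move/biclosed_poset_leE => GH; apply/biclosed_poset_leE; apply: setDS.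
Qed.

(** This hull property yields the suprema; [aff_coclosed_hull] provides it for the positive affine
    roots. *)
Hypothesis coclosed_hull : forall S : set U, S `<=` Psi ->
  closed_in Psi (Psi `\` S) -> exists C : set U, [/\ biclosed Psi C, S `<=` C &
    forall G, closed_in Psi G -> S `<=` G -> C `<=` G].

Lemma biclosed_sup (A : set (biclosed_poset Psi)) : exists j, supremums A j.
Proof.
pose S := \bigcup_(G in A) val G.
have SP : S `<=` Psi by move=> x [G _ Gx]; have [[GP _] _] := biclosedP G; exact: GP.
(* The complement of the union is an intersection of closed sets. *)
have cS : closed_in Psi (Psi `\` S).
  split=> [x []//|a b k1 k2 [aP aS] [bP bS] k10 k20 abP]; split=> // -[G AG Gab].
  have [_ [_ cG]] := biclosedP G.
  have [] := cG a b k1 k2 _ _ k10 k20 abP; last by [].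
    by split=> // Ga; apply: aS; exists G.
  by split=> // Gb; apply: bS; exists G.
have [C [bC SC minC]] := coclosed_hull SP cS.
exists (mk_biclosed bC); split=> [G AG|H HA].
  by apply/biclosed_poset_leE => x Gx; apply: SC; exists G.
apply/biclosed_poset_leE; apply: minC; first by have [] := biclosedP H.
by move=> x [G AG Gx]; have /biclosed_poset_leE := HA G AG; apply.
Qed.

(** De Morgan: complement the supremum of the complements. *)
Lemma biclosed_inf (A : set (biclosed_poset Psi)) : exists m, infimums A m.
Proof.
have [j [ub lub]] := biclosed_sup (bicompl @` A).
exists (bicompl j); split=> [G AG|H HA].
  by rewrite -[G]bicomplK; apply/bicompl_anti/ub; exists G.
rewrite -[H]bicomplK; apply/bicompl_anti/lub => _ [G AG <-].
exact/bicompl_anti/HA.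
Qed.

Lemma biclosed_complete_ortholattice : is_complete_ortholattice (biclosed_poset Psi).
Proof.
split; last by move=> A; split; [exact: biclosed_inf|exact: biclosed_sup].
split; first by move=> x y; split; [exact: biclosed_inf|exact: biclosed_sup].
have bot_le (G : biclosed_poset Psi) : (mk_biclosed biclosed_set0 <= G)%O.
  by apply/biclosed_poset_leE; apply: sub0set.
have le_top (G : biclosed_poset Psi) : (G <= mk_biclosed biclosed_setT)%O.
  by apply/biclosed_poset_leE; have [[]] := biclosedP G.
exists (mk_biclosed biclosed_set0), (mk_biclosed biclosed_setT), bicompl; split.
- by move=> G; rewrite bot_le le_top.
- exact: bicomplK.
- exact: bicompl_anti.
- move=> G; split=> [H _|H HG]; first exact: bot_le.
  apply/biclosed_poset_leE => x Hx.
  have /biclosed_poset_leE/(_ x Hx) Gx := HG G (or_introl erefl).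
  by have /biclosed_poset_leE/(_ x Hx) [] := HG (bicompl G) (or_intror erefl).
- move=> G; split=> [H _|H HG]; first exact: le_top.
  apply/biclosed_poset_leE => x Px.
  have [Gx|nGx] := EM (val G x).
    by have /biclosed_poset_leE := HG G (or_introl erefl); apply.
  by have /biclosed_poset_leE := HG (bicompl G) (or_intror erefl); apply.
Qed.

End BiclosedLattice.

(** * Transfer between real affine roots and integer triples *)

(** Cramer's rule for two coordinates f, g with nonzero minor m: the real coefficients k1, k2 are
    quotients of integers, and scaling by m * m keeps these positive. *)
Lemma between_of_real (R : realType) (a z b : vec * int) (f g : vec * int -> int)
    (k1 k2 : R) : 0 < k1 -> 0 < k2 ->
  z.1.1%:~R = k1 * a.1.1%:~R + k2 * b.1.1%:~R ->
  z.1.2%:~R = k1 * a.1.2%:~R + k2 * b.1.2%:~R ->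
  z.2%:~R = k1 * a.2%:~R + k2 * b.2%:~R ->
  (f z)%:~R = k1 * (f a)%:~R + k2 * (f b)%:~R ->
  (g z)%:~R = k1 * (g a)%:~R + k2 * (g b)%:~R ->
  f a * g b - g a * f b != 0 -> between a z b.
Proof.
move=> k10 k20 e1 e2 e3 ef eg; set m := f a * g b - g a * f b => m0.
have mR : (m%:~R : R) != 0 by rewrite intr_eq0.
have mm : 0 < m * m by rewrite lt0r mulf_neq0 //= -expr2 sqr_ge0.
have mmR : 0 < (m%:~R * m%:~R : R) by rewrite -intrM ltr0z.
pose p := m * (f z * g b - g z * f b); pose q := m * (f a * g z - g a * f z).
have ep : p%:~R = k1 * (m%:~R * m%:~R).
  rewrite /p /m !(intrM, intrB, ef, eg); ring.
have eq : q%:~R = k2 * (m%:~R * m%:~R).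
  rewrite /q /m !(intrM, intrB, ef, eg); ring.
move: m m0 mR mm mmR p q ep eq => m m0 mR mm mmR p q ep eq.
exists (m * m), p, q; split=> //.
- by rewrite -(ltr0z R) ep mulr_gt0.
- by rewrite -(ltr0z R) eq mulr_gt0.
by split; apply: (@intr_inj R); rewrite !(intrM, intrD) ep eq ?e1 ?e2 ?e3 //; ring.
Qed.

Section Embedding.
Context {R : realType} {V : vectType R} (ip : {dot V for idfun}).
Variables (Phi : seq V) (Pi : 2.-tuple V) (X : rank2_type) (s : 'S_2).
Hypotheses (hPhi : root_system ip Phi) (hred : reduced Phi).
Hypothesis hPi : simple_system Phi Pi.
Hypothesis hs : forall i j : 'I_2,
  cartan_number ip (tnth Pi (s i)) (tnth Pi (s j)) = (cartan_matrix X i j)%:~R.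

Local Notation root_vec := (comb_vec Pi s).
Local Notation affine := (pos_affine X).
Local Notation Psi := (aff_pos Phi Pi).

Lemma root_vecN c : root_vec (- c) = - root_vec c.
Proof. by rewrite /comb_vec /comb /= !rmorphN !scaleNr opprD. Qed.

Lemma root_coords v : v \in Phi -> exists2 c, c \in coords X & v = root_vec c.
Proof.
move=> vPhi; have ev := comb_coord s hPi v.
set x := coord Pi (s 0) v in ev; set y := coord Pi (s 1) v in ev.
have hv : comb Pi s x y \in Phi by rewrite -ev.
have [[x0 y0]|[x0 y0]] := root_sign hPi hv.
  have [c cT ec] := positive_root_coords hPhi hred hPi hs hv x0 y0.
  by exists c; rewrite ?mem_cat ?cT ?ev.
have hN : comb Pi s (- x) (- y) = - v by rewrite ev /comb !scaleNr opprD.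
have hv' : comb Pi s (- x) (- y) \in Phi by rewrite hN (root_opp hPhi).
have [||c cT ec] := positive_root_coords hPhi hred hPi hs hv'; rewrite ?oppr_ge0 //.
exists (- c); first by rewrite mem_cat map_f ?orbT.
by rewrite root_vecN -ec hN opprK.
Qed.

Lemma pos_root_height c : c \in coords X -> pos_root Phi Pi (root_vec c) = (0 < height c).
Proof.
move=> cT.
have H : all (fun c : vec => ((0 <= c.1) && (0 <= c.2)) == (0 < height c)) (coords X).
  by case: (X); vm_compute.
rewrite -(eqP (allP H _ cT)) /pos_root /= (coords_root hPhi hPi hs cT) /=.
have [e1 e2] := coord_comb s hPi (c.1%:~R : R) c.2%:~R.
apply/forallP/andP => [h|[h1 h2] i].
  by have := h (s 0); have := h (s 1); rewrite /comb_vec e1 e2 !ler0z => -> ->.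
rewrite -(permKV s i); case: (_ i) => -[|[|//]] j.
  have -> : Ordinal j = 0 by apply: val_inj.
  by rewrite e1 ler0z.
have -> : Ordinal j = 1 by apply: val_inj.
by rewrite e2 ler0z.
Qed.

Definition emb (x : vec * int) : (V * R^o)%type := (root_vec x.1, x.2%:~R).

Lemma aff_rootE c (k : nat) : aff_root (root_vec c) k = emb (c, k%:Z).
Proof.
rewrite /aff_root /emb /delta; congr pair => /=.
  by rewrite scaler0 addr0.
by rewrite add0r /GRing.scale /= mulr1 pmulrn.
Qed.

(** As heights are nonzero and below 50 in absolute value, a positive level means i >= 0 for
    positive c and i >= 1 for negative c, which are the two cases of [hat]. *)
Lemma aff_posP w : Psi w <-> exists2 x, affine x & w = emb x.
Proof.
split=> [[v /= vPhi]|[[c i] /andP[/= cT lv] ->]].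
  have [c cT ->] := root_coords vPhi; have [c0 cb] := height_bound cT.
  rewrite /hat pos_root_height //; case: ifP => hc [k _ <-].
    by exists (c, k%:Z); rewrite ?aff_rootE // /pos_affine /= cT /level /=; lia.
  by exists (c, k.+1%:Z); rewrite ?aff_rootE // /pos_affine /= cT /level /=; lia.
have [c0 cb] := height_bound cT.
exists (root_vec c); first exact: (coords_root hPhi hPi hs cT : (_ \in _)).
move: lv; rewrite /level /hat pos_root_height //=; case: ifP => hc lv.
  by exists `|i|%N => //; rewrite aff_rootE; congr (emb (c, _)); lia.
by exists (`|i|.-1)%N => //; rewrite aff_rootE; congr (emb (c, _)); lia.
Qed.

Lemma emb_aff x : affine x -> Psi (emb x).
Proof. by move=> xA; apply/aff_posP; exists x. Qed.

Lemma emb_coords a z b (k1 k2 : R) : emb z = k1 *: emb a + k2 *: emb b ->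
  [/\ z.1.1%:~R = k1 * a.1.1%:~R + k2 * b.1.1%:~R,
      z.1.2%:~R = k1 * a.1.2%:~R + k2 * b.1.2%:~R &
      z.2%:~R = k1 * a.2%:~R + k2 * b.2%:~R].
Proof.
move=> e; have /= e1 := congr1 fst e; have /= e2 := congr1 snd e.
have : root_vec z.1 = comb Pi s (k1 * a.1.1%:~R + k2 * b.1.1%:~R)
    (k1 * a.1.2%:~R + k2 * b.1.2%:~R).
  by rewrite e1 /comb_vec /comb !scalerDr !scalerA addrACA -!scalerDl.
by case/(comb_inj hPi).
Qed.

Lemma emb_inj x y : emb x = emb y -> x = y.
Proof.
move=> e; move: x y e => [[a b] c] [[a' b'] c'] e.
have /= e1 := congr1 fst e; have /= e2 := congr1 snd e.
have [/= /intr_inj -> /intr_inj ->] := comb_inj hPi e1.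
by move/intr_inj: e2 => ->.
Qed.

Lemma between_emb a z b : between a z b ->
  exists k1 k2 : R, [/\ 0 < k1, 0 < k2 & emb z = k1 *: emb a + k2 *: emb b].
Proof.
move=> [D [p [q [D0 p0 q0 [e1 e2 e3]]]]].
have DR : (D%:~R : R) != 0 by rewrite intr_eq0; lia.
have cast (x y w : int) : D * w = p * x + q * y ->
    w%:~R = p%:~R / D%:~R * x%:~R + q%:~R / D%:~R * y%:~R :> R.
  move=> e; apply: (mulfI DR); rewrite -intrM e intrD !intrM.
  by field.
exists (p%:~R / D%:~R), (q%:~R / D%:~R); split.
- by rewrite divr_gt0 ?ltr0z.
- by rewrite divr_gt0 ?ltr0z.
rewrite /emb /comb_vec (cast _ _ _ e1) (cast _ _ _ e2) (cast _ _ _ e3).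
congr pair => /=.
by rewrite /comb !scalerDr !scalerA addrACA -!scalerDl.
Qed.

(** If some 2 by 2 minor of a and b is nonzero, [between_of_real] applies. Otherwise a and b are
    parallel; being positive they are equal, and z = a. *)
Lemma emb_between a z b (k1 k2 : R) : affine a -> affine z -> affine b ->
  0 < k1 -> 0 < k2 -> emb z = k1 *: emb a + k2 *: emb b -> between a z b.
Proof.
move=> aA zA bA k10 k20 /emb_coords[e1 e2 e3].
pose x1 (w : vec * int) := w.1.1; pose x2 (w : vec * int) := w.1.2.
pose x3 (w : vec * int) := w.2.
have Bt f g := @between_of_real R a z b f g k1 k2 k10 k20 e1 e2 e3.
have [m12|/(Bt x1 x2 e1 e2)//] := eqVneq (x1 a * x2 b - x2 a * x1 b) 0.
have [m13|/(Bt x1 x3 e1 e3)//] := eqVneq (x1 a * x3 b - x3 a * x1 b) 0.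
have [m23|/(Bt x2 x3 e2 e3)//] := eqVneq (x2 a * x3 b - x3 a * x2 b) 0.
rewrite {}/x1 {}/x2 {}/x3 in m12 m13 m23 Bt *; clear Bt.
move: (aA) (zA) (bA) => /andP[aT a0] /andP[zT z0] /andP[bT b0].
have [ha _] := height_bound aT.
have [eb|eb] := vdet_eq0 aT bT m12; rewrite eb /= in m13 m23.
  have /(mulfI ha) eb2 : height a.1 * b.2 = height a.1 * a.2.
    by move: m13 m23; rewrite /height; lia.
  have {eb eb2} ab : b = a by rewrite (surjective_pairing b) eb eb2 -surjective_pairing.
  subst b; rewrite -!mulrDl in e1 e2 e3.
  have d0 : vdet a.1 z.1 = 0.
    by apply: (@intr_inj R); rewrite /vdet rmorphB !rmorphM /= e1 e2; ring.
  have hR : (height a.1)%:~R != 0 :> R by rewrite intr_eq0.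
  have eh : (height z.1)%:~R = (k1 + k2) * (height a.1)%:~R :> R.
    by rewrite /height !rmorphD !rmorphM /= e1 e2; ring.
  have k0 : 0 < k1 + k2 by rewrite addr_gt0.
  have [ez|ez] := vdet_eq0 aT zT d0; rewrite ez in eh; last first.
    rewrite heightN rmorphN /= -mulN1r in eh; move/(mulIf hR): eh => eh.
    by move: k0; rewrite -eh oppr_gt0 ltr10.
  have {}eh : k1 + k2 = 1 by apply: (mulIf hR); rewrite -eh mul1r.
  have ez2 : z.2 = a.2 by apply: (@intr_inj R); rewrite e3 eh mul1r.
  have -> : z = a by rewrite (surjective_pairing z) ez ez2 -surjective_pairing.
  by exists 2, 1, 1; split=> //; split; ring.
have ab : a.2 + b.2 = 0.
  by apply: (mulfI ha); rewrite mulr0; move: m13 m23; rewrite /height; lia.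
by move: a0 b0; rewrite /level eb heightN; lia.
Qed.

Lemma emb_cone a z b (k1 k2 : R) : affine a -> affine z -> affine b ->
  0 <= k1 -> 0 <= k2 -> emb z = k1 *: emb a + k2 *: emb b ->
  [\/ z = a, z = b | between a z b].
Proof.
move=> aA zA bA; rewrite !le0r => h1 h2 e.
(* Splitting k into two halves makes this the case a = b of [emb_between]. *)
have half (x : vec * int) (k : R) : affine x -> 0 < k -> emb z = k *: emb x -> z = x.
  move=> xA k0 ex; apply: (between_diag xA zA).
  have k2' : 0 < k / 2 by rewrite divr_gt0.
  by apply: (emb_between xA zA xA k2' k2'); rewrite -scalerDl -splitr.
case/orP: h1 e => [/eqP->|k10]; case/orP: h2 => [/eqP->|k20] e.
- exfalso; have /andP[zT _] := zA; have [hz _] := height_bound zT.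
  have [e1 e2 _] := emb_coords e; move: e1 e2; rewrite !mul0r addr0 => e1 e2.
  move/eqP: hz; apply; apply: (@intr_inj R).
  by rewrite /height rmorphD rmorphM /= e1 e2 mulr0 addr0.
- by rewrite scale0r add0r in e; constructor 2; apply: half e.
- by rewrite scale0r addr0 in e; constructor 1; apply: half e.
by constructor 3; apply: emb_between e.
Qed.

(** The hull is the image of [generated] for the preimage of S. It is minimal because a closed set
    containing S is stable under every generating step. *)
Lemma aff_coclosed_hull (S : set (V * R^o)%type) : S `<=` Psi ->
  closed_in Psi (Psi `\` S) -> exists C, [/\ biclosed Psi C, S `<=` C &
    forall G, closed_in Psi G -> S `<=` G -> C `<=` G].
Proof.
move=> SP [_ cS].
pose S' x := affine x /\ S (emb x).
have coS a z b : affine a -> affine z -> affine b -> between a z b ->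
    S' z -> S' a \/ S' b.
  move=> aA zA bA /between_emb[k1 [k2 [k10 k20 e]]] [_ Sz].
  apply: contrapT => /not_orP[Na Nb].
  have [] := cS (emb a) (emb b) k1 k2 _ _ (ltW k10) (ltW k20) _; rewrite -?e //.
  - by split; [exact: emb_aff|move=> Sa; apply: Na].
  - by split; [exact: emb_aff|move=> Sb; apply: Nb].
  - exact: emb_aff.
have gen_aff x : generated X S' x -> affine x by case=> [y []|].
have bc := generated_biclosed coS.
pose C := [set emb x | x in generated X S'].
have memC x : C (emb x) <-> generated X S' x.
  by split=> [[y gy /emb_inj <-]|gx] //; exists x.
exists C; split.
- (split; split)=> [w [x gx <-]|a b k1 k2 [x gx <-] [y gy <-] k10 k20|w []//|a b k1 k2].
  + exact/emb_aff/gen_aff.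
  + case/aff_posP => z zA e; rewrite e; apply/memC.
    have [xA yA] := (gen_aff _ gx, gen_aff _ gy).
    have [->|->|xzy] // := emb_cone xA zA yA k10 k20 (esym e).
    by have [h _] := bc x z y xA zA yA xzy; apply: h.
  move=> [/aff_posP[x xA ->] /memC nx] [/aff_posP[y yA ->] /memC ny] k10 k20.
  move=> abP; split=> //; case/aff_posP: abP => z zA e; rewrite e => /memC.
  have [->|->|xzy] // := emb_cone xA zA yA k10 k20 (esym e).
  by have [_ h] := bc x z y xA zA yA xzy; apply: h.
- move=> w Sw; have /aff_posP[x xA ex] := SP _ Sw; rewrite ex.
  by apply/memC; apply: Generator; rewrite /S' -ex.
move=> G [_ cG] SG w [x gx <-]; elim: gx => [y [_ Sy]|a z b aA zA bA _ _ azb _ Ga _ Gb].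
  exact: SG.
have [k1 [k2 [k10 k20 e]]] := between_emb azb.
by rewrite e; apply: cG => //; rewrite ?ltW // -e; apply: emb_aff.
Qed.

End Embedding.

Theorem theorem4p11 (R : realType) (V : vectType R) (ip : {dot V for idfun})
    (Phi : seq V) (Pi : 2.-tuple V) (X : rank2_type)
    (hPhi : root_system ip Phi) (hcrys : crystallographic ip Phi)
    (hred : reduced Phi) (hirr : irreducible ip Phi)
    (hPi : simple_system Phi Pi) (hX : has_type ip X Pi) :
  is_complete_ortholattice (biclosed_poset (aff_pos Phi Pi)).
Proof.
have [s hs] := hX; apply: biclosed_complete_ortholattice.
exact: (aff_coclosed_hull hPhi hred hPi hs).
Qed.
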